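(* Let $I=(\alpha,\infty)$ be an interval, let $a,b,c,d$ be real numbers with $a,c\ge 0$, $a^2+b^2\ne 0$ and $c^2+d^2\ne 0$. Then $$f(x)=\log\left(\frac{ax+b}{cx+d}\right)$$ is completely monotone in $I$ if and only if one of the following conditions holds: (1) $a=0$, $c=0$, and $0<d\le b$ or $0>d\ge b$, and $\alpha$ is arbitrary; (2) $a>0$, $c=a$, $d=b$, $\alpha\ge -d/c$; (3) $a>0$, $c=a$, $b>d$, $\alpha\ge -d/c$; (4) $a>0$, $a>c>0$, $ad-bc\le 0$, $\alpha\ge -d/c$.
   Context: A function $f:I\to\mathbb{R}$ on an interval $I\subseteq\mathbb{R}$ is called completely monotone if it has derivatives of all orders and $(-1)^n f^{(n)}(x)\ge 0$ for all $n=0,1,2,\ldots$ and all $x\in I$. In particular, complete monotonicity of $f$ in $I$ includes that the formula for $f$ defines a real number at every point of $I$, i.e. $cx+d\ne0$ and $(ax+b)/(cx+d)>0$ for all $x\in I$. *)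

(* Defs.v *)
From Stdlib Require Import Reals.
From Coquelicot Require Import Coquelicot.
Open Scope R_scope.

(* The interval (alpha, +oo); the endpoint may be m_infty. *)
Definition right_ray (alpha : Rbar) (x : R) : Prop := Rbar_lt alpha (Finite x).

(* [ex_derive_n] and [Derive_n] are two-sided, so [I] is meant to be open. *)
Definition completely_monotone (I : R -> Prop) (f : R -> R) : Prop :=
  forall (n : nat) (x : R), I x ->
    ex_derive_n f n x /\ 0 <= (-1) ^ n * Derive_n f n x.

Definition log_mobius (a b c d x : R) : R := ln ((a * x + b) / (c * x + d)).

(* Since [/] and [ln] are total functions, the requirement that the formula
   [log_mobius] makes sense as a real number at [x] is stated separately. *)
Definition log_mobius_defined (a b c d x : R) : Prop :=
  c * x + d <> 0 /\ 0 < (a * x + b) / (c * x + d).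

(* "log ((a x + b) / (c x + d)) is completely monotone in [I]" for the partial
   function given by this formula. *)
Definition log_mobius_completely_monotone (I : R -> Prop) (a b c d : R) : Prop :=
  (forall x : R, I x -> log_mobius_defined a b c d x) /\
  completely_monotone I (log_mobius a b c d).

(* Main.v *)
(* Where [a x + b] and [c x + d] are positive, the derivative of order [n + 1]
   of the function is [(-1)^n n! ((a / (a x + b))^(n+1) - (c / (c x + d))^(n+1))],
   so all the sign conditions on derivatives reduce to
   [a / (a x + b) <= c / (c x + d)], that is to [a d <= b c].  Nonnegativity of
   the function itself is [(a x + b) / (c x + d) >= 1], which gives [c <= a] as
   [x] tends to infinity. *)
Require Import Defs.
From Stdlib Require Import Reals Lra Factorial.
From Coquelicot Require Import Coquelicot.
Open Scope R_scope.

Lemma locally_affine_pos (a b x : R) :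
  0 < a * x + b -> locally x (fun y => 0 < a * y + b).
Proof.
  intros h.
  apply (open_comp (fun y => a * y + b) (fun z => 0 < z)).
  - intros y _. apply (ex_derive_continuous (fun y => a * y + b)).
    auto_derive. trivial.
  - apply open_gt.
  - exact h.
Qed.

(** The quotient [q = a / (a * x + b)] satisfies [q' = - q ^ 2], so differentiating [q ^ S n]
    multiplies it by [- INR (S n) * q]. This turns [n!] into [(n + 1)!] and flips the sign. *)
Lemma is_derive_n_ln_affine (a b : R) (n : nat) (x : R) :
  0 < a * x + b ->
  is_derive_n (fun y => ln (a * y + b)) (S n) x
    ((-1) ^ n * INR (fact n) * (a / (a * x + b)) ^ S n).
Proof.
  revert x. induction n as [|n IH]; intros x hx.
  - simpl. auto_derive; [exact hx | field; lra].
  (* The induction hypothesis holds only where the affine form is positive, so the derivative is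
     identified with its formula on a neighbourhood of [x]. *)
  - apply (is_derive_ext_loc
      (fun y => (-1) ^ n * INR (fact n) * (a / (a * y + b)) ^ S n)).
    + apply filter_imp with (2 := locally_affine_pos a b x hx).
      intros y hy. symmetry. apply is_derive_n_unique, IH, hy.
    + assert (hq : is_derive (fun y => a / (a * y + b)) x
                     (- (a / (a * x + b)) ^ 2)).
      { auto_derive; [lra | field; lra]. }
      pose proof (is_derive_scal _ _ ((-1) ^ n * INR (fact n)) _
                    (is_derive_pow _ (S n) _ _ hq)) as h.
      cbv beta in h.
      replace ((-1) ^ S n * INR (fact (S n)) * (a / (a * x + b)) ^ S (S n))
        with ((-1) ^ n * INR (fact n) *
              (INR (S n) * - (a / (a * x + b)) ^ 2 *
               (a / (a * x + b)) ^ Nat.pred (S n))); [exact h |].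
      rewrite fact_simpl, mult_INR. simpl Nat.pred. rewrite <- !tech_pow_Rmult.
      ring.
Qed.

Lemma is_derive_n_log_mobius (a b c d : R) (n : nat) (x : R) :
  0 < a * x + b -> 0 < c * x + d ->
  is_derive_n (log_mobius a b c d) (S n) x
    ((-1) ^ n * INR (fact n) *
     ((a / (a * x + b)) ^ S n - (c / (c * x + d)) ^ S n)).
Proof.
  intros hx hx'.
  apply (is_derive_n_ext_loc (fun y => ln (a * y + b) - ln (c * y + d))).
  - apply filter_imp with
      (2 := filter_and _ _ (locally_affine_pos a b x hx)
              (locally_affine_pos c d x hx')).
    intros y [hy hy']. unfold log_mobius. symmetry. apply ln_div; assumption.
  - rewrite Rmult_minus_distr_l.
    apply is_derive_n_minus; try (now apply is_derive_n_ln_affine).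
    + apply filter_imp with (2 := locally_affine_pos a b x hx).
      intros y hy [|k] _; [exact I |].
      eexists; now apply (is_derive_n_ln_affine a b k).
    + apply filter_imp with (2 := locally_affine_pos c d x hx').
      intros y hy [|k] _; [exact I |].
      eexists; now apply (is_derive_n_ln_affine c d k).
Qed.

Lemma ln_nonneg (y : R) : 1 <= y -> 0 <= ln y.
Proof. intros h. rewrite <- ln_1. apply ln_le; lra. Qed.

Lemma ln_nonneg_inv (y : R) : 0 < y -> 0 <= ln y -> 1 <= y.
Proof.
  intros hy h. destruct (Rle_lt_dec 1 y) as [|hlt]; [assumption |].
  pose proof (ln_increasing y 1 hy hlt). rewrite ln_1 in *. lra.
Qed.

(** Sufficiency for the conditions with [c > 0]. *)
Lemma log_mobius_cm_of_le (I : R -> Prop) (a b c d : R) :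
  (forall x, I x -> 0 < c * x + d <= a * x + b) ->
  0 <= a -> 0 <= c -> a * d <= b * c ->
  log_mobius_completely_monotone I a b c d.
Proof.
  intros hI ha hc hdet. split.
  - intros x hx. destruct (hI x hx). split; [lra |].
    apply Rdiv_lt_0_compat; lra.
  - intros [|n] x hx; destruct (hI x hx) as [h1 h2].
    + split; [exact Logic.I |]. simpl. rewrite Rmult_1_l.
      apply ln_nonneg, Rle_div_r; lra.
    + assert (hd := is_derive_n_log_mobius a b c d n x ltac:(lra) h1).
      split; [now eexists; apply hd |].
      rewrite (is_derive_n_unique _ _ _ _ hd).
      (* After clearing denominators the terms [a * c * x] cancel, leaving [a * d <= b * c]. *)
      assert (hle : a / (a * x + b) <= c / (c * x + d)).
      { apply Rle_div_l; [lra |].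
        replace (c / (c * x + d) * (a * x + b))
          with (c * (a * x + b) / (c * x + d)) by (field; lra).
        apply Rle_div_r; [lra | nra]. }
      assert (h0 : 0 <= a / (a * x + b)) by (apply Rle_div_r; lra).
      pose proof (pow_incr _ _ (S n) (conj h0 hle)) as hp.
      assert (hs : (-1) ^ n * (-1) ^ n = 1).
      { rewrite <- Rpow_mult_distr. replace (-1 * -1) with 1 by ring. apply pow1. }
      (* The odd total sign reverses the difference of powers. *)
      replace ((-1) ^ S n * _)
        with ((-1) ^ n * (-1) ^ n * INR (fact n) *
              ((c / (c * x + d)) ^ S n - (a / (a * x + b)) ^ S n))
        by (rewrite <- (tech_pow_Rmult (-1) n); ring).
      rewrite hs, Rmult_1_l.
      apply Rmult_le_pos; [apply pos_INR | lra].
Qed.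

(** Kept apart because numerator and denominator may both be negative here; the function is the
    constant [ln (b / d)]. *)
Lemma log_mobius_cm_const (I : R -> Prop) (b d : R) :
  (0 < d /\ d <= b) \/ (0 > d /\ d >= b) ->
  log_mobius_completely_monotone I 0 b 0 d.
Proof.
  intros h.
  assert (hq : 1 <= b / d).
  { destruct h as [h | h]; [apply Rle_div_r; lra |].
    replace (b / d) with (- b / - d) by (field; lra). apply Rle_div_r; lra. }
  assert (he : forall y, (0 * y + b) / (0 * y + d) = b / d).
  { intros y. rewrite !Rmult_0_l, !Rplus_0_l. reflexivity. }
  split.
  - intros x _. split; [lra |]. rewrite he; lra.
  - intros n x _. split.
    + apply ex_derive_n_ext with (f := fun _ => ln (b / d)).
      * intros y. unfold log_mobius. now rewrite he.
      * destruct n; [exact Logic.I | apply ex_derive_n_const].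
    + rewrite (Derive_n_ext _ (fun _ => ln (b / d)))
        by (intros y; unfold log_mobius; now rewrite he).
      destruct n.
      * simpl. rewrite Rmult_1_l. now apply ln_nonneg.
      * rewrite Derive_n_const. lra.
Qed.

Lemma right_ray_unbounded (alpha : Rbar) (M : R) :
  alpha <> p_infty -> exists x, right_ray alpha x /\ M < x.
Proof.
  intros h. destruct alpha as [r | |]; [| easy |].
  - exists (Rmax r M + 1). simpl.
    pose proof (Rmax_l r M); pose proof (Rmax_r r M).
    unfold right_ray; simpl; lra.
  - exists (M + 1). unfold right_ray; simpl. split; [trivial | lra].
Qed.

Lemma log_mobius_cm_ge_1 (I : R -> Prop) (a b c d x : R) :
  log_mobius_completely_monotone I a b c d -> I x ->
  1 <= (a * x + b) / (c * x + d).
Proof.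
  intros [hdef hcm] hx. destruct (hdef x hx) as [_ hpos].
  destruct (hcm O x hx) as [_ h]. simpl in h. unfold log_mobius in h.
  apply ln_nonneg_inv; lra.
Qed.

Lemma log_mobius_cm_affine_le (I : R -> Prop) (a b c d x : R) :
  log_mobius_completely_monotone I a b c d -> I x -> 0 < c * x + d ->
  c * x + d <= a * x + b.
Proof.
  intros h hx hpos. pose proof (log_mobius_cm_ge_1 _ _ _ _ _ _ h hx) as h1.
  apply Rle_div_r in h1; lra.
Qed.

(** The first derivative at a single point suffices: over the common denominator its numerator is
    [a * d - b * c], free of [x]. *)
Lemma log_mobius_cm_det (I : R -> Prop) (a b c d x : R) :
  log_mobius_completely_monotone I a b c d -> I x -> 0 < c * x + d ->
  a * d <= b * c.
Proof.
  intros h hx hpos.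
  pose proof (log_mobius_cm_affine_le _ _ _ _ _ _ h hx hpos) as hle.
  destruct h as [_ hcm]. destruct (hcm 1%nat x hx) as [_ h1].
  assert (hx' : 0 < a * x + b) by lra.
  rewrite (is_derive_n_unique _ _ _ _
    (is_derive_n_log_mobius a b c d 0 x hx' hpos)) in h1.
  simpl in h1.
  assert (h2 : 0 <= (b * c - a * d) / ((a * x + b) * (c * x + d))).
  { replace ((b * c - a * d) / _) with (c / (c * x + d) - a / (a * x + b))
      by (field; lra). lra. }
  apply Rle_div_r in h2; [lra | now apply Rmult_lt_0_compat].
Qed.

Lemma affine_le_slope (alpha : Rbar) (M a b c d : R) :
  alpha <> p_infty ->
  (forall x, right_ray alpha x -> M < x -> c * x + d <= a * x + b) -> c <= a.
Proof.
  intros halpha h. destruct (Rle_lt_dec c a) as [|hlt]; [assumption |].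
  (* If [c > a], the two lines cross at [(b - d) / (c - a)], and the inequality fails beyond that
     point. *)
  destruct (right_ray_unbounded alpha (Rmax M ((b - d) / (c - a))) halpha)
    as [x [hx hM]].
  apply Rmax_Rlt in hM. destruct hM as [hM hq].
  apply Rlt_div_l in hq; [| lra].
  specialize (h x hx hM). lra.
Qed.

Theorem theorem2p13 (alpha : Rbar) (a b c d : R)
  (halpha : alpha <> p_infty)
  (ha : 0 <= a) (hc : 0 <= c)
  (hab : a ^ 2 + b ^ 2 <> 0) (hcd : c ^ 2 + d ^ 2 <> 0) :
  log_mobius_completely_monotone (right_ray alpha) a b c d
  <->
  ( (a = 0 /\ c = 0 /\ ((0 < d /\ d <= b) \/ (0 > d /\ d >= b)))
    \/ (a > 0 /\ c = a /\ d = b /\ Rbar_le (Finite (- d / c)) alpha)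
    \/ (a > 0 /\ c = a /\ b > d /\ Rbar_le (Finite (- d / c)) alpha)
    \/ (a > 0 /\ (a > c /\ c > 0) /\ a * d - b * c <= 0
        /\ Rbar_le (Finite (- d / c)) alpha) ).
Proof.
  split.
  - intros h. destruct hc as [hc | <-].
    + assert (hM : forall x, - d / c < x -> 0 < c * x + d).
      { intros x hx. apply Rlt_div_l in hx; lra. }
      assert (hca : c <= a).
      { apply (affine_le_slope alpha (- d / c) a b c d halpha).
        intros x hx hx'. now apply (log_mobius_cm_affine_le _ _ _ _ _ _ h), hM. }
      assert (hdet : a * d <= b * c).
      { destruct (right_ray_unbounded alpha (- d / c) halpha) as [x [hx hx']].
        exact (log_mobius_cm_det _ _ _ _ _ _ h hx (hM x hx')). }
      assert (hle : Rbar_le (Finite (- d / c)) alpha).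
      (* Otherwise the ray would contain the pole [- d / c]. *)
      { apply Rbar_not_lt_le. intros hlt.
        destruct h as [hdef _]. destruct (hdef _ hlt) as [hne _].
        apply hne. field. lra. }
      right. destruct hca as [hlt | ->].
      * right; right. repeat split; try assumption; lra.
      (* With equal slopes, [hdet] reads [a * d <= b * a], and [a > 0] cancels. *)
      * assert (hdb : d <= b) by nra.
        destruct hdb; [right; left | left]; repeat split; assumption.
    + left. assert (hd : d <> 0) by (intros ->; apply hcd; ring).
      destruct (right_ray_unbounded alpha 0 halpha) as [x [hx _]].
      pose proof (log_mobius_cm_ge_1 _ _ _ _ _ _ h hx) as hx1.
      destruct (Rlt_or_le 0 d) as [hpos | hneg].
      * assert (hx' : 0 < 0 * x + d) by lra.
        pose proof (log_mobius_cm_affine_le _ _ _ _ _ _ h hx hx').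
        pose proof (log_mobius_cm_det _ _ _ _ _ _ h hx hx').
        (* For [c = 0] the determinant inequality is [a * d <= 0], with [d > 0]. *)
        assert (a = 0) by nra. subst a. repeat split; left; lra.
      (* For [d < 0] a ratio of at least 1 bounds the numerator above by [d] on the whole ray, which
         excludes a positive slope [a]. *)
      * assert (hle : forall y, right_ray alpha y -> a * y + b <= d).
        { intros y hy.
          pose proof (log_mobius_cm_ge_1 _ _ _ _ _ _ h hy) as hy1.
          replace ((a * y + b) / (0 * y + d)) with (- (a * y + b) / - d) in hy1
            by (field; lra).
          apply Rle_div_r in hy1; lra. }
        assert (a <= 0).
        { apply (affine_le_slope alpha 0 0 d a b halpha).
          intros y hy _. specialize (hle y hy). lra. }
        assert (a = 0) by lra. subst a. specialize (hle x hx).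
        repeat split; right; lra.
  - intros h.
    (* The three conditions with [a > 0] merge into [0 < c <= a] and [a * d <= b * c], with the pole
       outside the ray. *)
    assert (hcase : (a = 0 /\ c = 0 /\ ((0 < d /\ d <= b) \/ (0 > d /\ d >= b)))
      \/ (0 < c <= a /\ a * d <= b * c /\ Rbar_le (Finite (- d / c)) alpha)).
    { destruct h as [h | [h | [h | h]]]; [now left | right ..];
        repeat split; try (now apply h); try lra.
      - destruct h as (? & -> & -> & _). lra.
      - destruct h as (? & -> & ? & _). nra. }
    destruct hcase as [(-> & -> & hbd) | (hca & hdet & hle)].
    + now apply log_mobius_cm_const.
    + apply log_mobius_cm_of_le; try assumption.
      intros x hx. pose proof (Rbar_le_lt_trans _ _ _ hle hx) as hq.
      simpl in hq. apply Rlt_div_l in hq; [| lra].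
      split; [lra |].
      (* [c (a x + b) >= a (c x + d) >= c (c x + d)] *)
      assert (c * (c * x + d) <= c * (a * x + b)) by nra.
      nra.
Qed.
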